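(* Let $a,b\in\mathbb{R}$, $\beta\ge 0$, $\alpha\ge 0$ with $\alpha\ne 1$ and $\beta-2\alpha+3\neq 0$. Let $(u_i(t))_{i\in\mathbb{T}_h}$, $t>0$, be a positive solution of the finite-difference scheme described in the context, let $S^h_\alpha=h\sum_{i\in\mathbb{T}_h}s_\alpha(u_i)$, and let $$K(\alpha,\beta)=-2\alpha^2+(3a-4\beta+9)\alpha-2\beta^2+(3a+9)\beta-9(a+b+1).$$ (i) If $K(\alpha,\beta)\ge 0$, then $dS_\alpha^h/dt\le 0$ for all $t>0$. (ii) If $K(\alpha,\beta)>0$, then there is a constant $c_0(\alpha,\beta)>0$ with $P(\xi_1,\xi_2)\ge c_0(\alpha,\beta)(\xi_2^2+\xi_1^4)$ for all $(\xi_1,\xi_2)\in\mathbb{R}^2$, where $$P(\xi_1,\xi_2)=(\lambda_1-\lambda_3)\xi_2^2+(\lambda_2-\lambda_3-\lambda_4)\xi_2\xi_1^2-\lambda_4\xi_1^4,$$ and with $c(\alpha,\beta)=c_0(\alpha,\beta)/(\alpha-1)^2$ one has for all $t>0$ $$\frac{dS_\alpha^h}{dt}+c(\alpha,\beta)\,h\sum_{i\in\mathbb{T}_h}\bar u_i^{\alpha+\beta}\big(\xi_{2,i}^2+\xi_{1,i}^4\big)\le 0 .$$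
   Context: Grid: $h=1/N$ with $N$ a positive integer, $\mathbb{T}_h$ is the discrete torus of grid size $h$, whose points are indexed by $i\in\mathbb{Z}/N\mathbb{Z}$ (index $i$ corresponds to the point $ih$), so indices are taken modulo $N$. Entropy: $s_\alpha(u)=\frac{u^\alpha}{\alpha(\alpha-1)}$ for $\alpha>0$, $\alpha\neq1$, and $s_0(u)=-\log u$; $v_i=s_\alpha'(u_i)=\frac{u_i^{\alpha-1}}{\alpha-1}$. Scheme (a system of ODEs in $t$): $$\partial_t u_i=-\frac1h(J_{i+1/2}-J_{i-1/2}),\qquad J_{i+1/2}=\frac1h(A_{i+1}-A_i)-\frac1{2h}(v_{i+1}+v_i)(B_{i+1}-B_i),$$ $$A_i=\frac{\bar u_i^{\alpha+\beta}}{(\alpha-1)^2v_i}\big(\lambda_1\xi_{2,i}+\lambda_2\xi_{1,i}^2\big),\qquad B_i=\frac{\bar u_i^{\alpha+\beta}}{(\alpha-1)^2v_i^2}\big(\lambda_3\xi_{2,i}+\lambda_4\xi_{1,i}^2\big),$$ $$\xi_{2,i}=\frac{1}{v_ih^2}(v_{i+1}-2v_i+v_{i-1}),\qquad \xi_{1,i}^2=\frac{1}{2v_i^2h^2}\big((v_{i+1}-v_i)^2+(v_i-v_{i-1})^2\big),$$ with $\xi_{1,i}^4=(\xi_{1,i}^2)^2$. Here $\bar u_i>0$ is an arbitrary average of the (positive) values of $u$ around the grid point $i$. Coefficients: $$\lambda_4=\frac{-2\alpha^2+(-3a+8\beta+3)\alpha-3a\beta+\beta^2+9(a+b)-15\beta}{9(\alpha-1)^2},$$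 $$\lambda_1=\frac{-2\alpha^2+(\beta+5)\alpha+a\beta-\beta^2-a-2b-3}{(\alpha-1)(\beta-2\alpha+3)}+\frac{2(\alpha-1)}{\beta-2\alpha+3}\lambda_4,$$ $$\lambda_2=\frac{2\alpha^2-(a+7)\alpha+2a+b+6}{(\alpha-1)(\beta-2\alpha+3)}+\frac{\beta-3\alpha+4}{\beta-2\alpha+3}\lambda_4,$$ $$\lambda_3=\frac{(a+1)\beta-\beta^2-a-2b}{(\alpha-1)(\beta-2\alpha+3)}+\frac{2(\alpha-1)}{\beta-2\alpha+3}\lambda_4.$$ *)

(* Defs.v *)
From HB Require Import structures.
From mathcomp Require Import all_boot all_order all_algebra.
From mathcomp Require Import all_classical all_reals all_analysis.
Set Implicit Arguments.
Unset Strict Implicit.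
Unset Printing Implicit Defensive.
Import Order.TTheory GRing.Theory Num.Theory.
Import numFieldNormedType.Exports.
Local Open Scope ring_scope.

Section Coefficients.
Variables (R : realType) (a b alpha beta : R).

Definition lambda4 : R :=
  (- 2 * alpha ^+ 2 + (- 3 * a + 8 * beta + 3) * alpha - 3 * a * beta
     + beta ^+ 2 + 9 * (a + b) - 15 * beta)
  / (9 * (alpha - 1) ^+ 2).

Definition lambda1 : R :=
  (- 2 * alpha ^+ 2 + (beta + 5) * alpha + a * beta - beta ^+ 2
     - a - 2 * b - 3)
  / ((alpha - 1) * (beta - 2 * alpha + 3))
  + 2 * (alpha - 1) / (beta - 2 * alpha + 3) * lambda4.

Definition lambda2 : R :=
  (2 * alpha ^+ 2 - (a + 7) * alpha + 2 * a + b + 6)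
  / ((alpha - 1) * (beta - 2 * alpha + 3))
  + (beta - 3 * alpha + 4) / (beta - 2 * alpha + 3) * lambda4.

Definition lambda3 : R :=
  ((a + 1) * beta - beta ^+ 2 - a - 2 * b)
  / ((alpha - 1) * (beta - 2 * alpha + 3))
  + 2 * (alpha - 1) / (beta - 2 * alpha + 3) * lambda4.

Definition K : R :=
  - 2 * alpha ^+ 2 + (3 * a - 4 * beta + 9) * alpha - 2 * beta ^+ 2
  + (3 * a + 9) * beta - 9 * (a + b + 1).

Definition P (xi1 xi2 : R) : R :=
  (lambda1 - lambda3) * xi2 ^+ 2
  + (lambda2 - lambda3 - lambda4) * xi2 * xi1 ^+ 2
  - lambda4 * xi1 ^+ 4.

End Coefficients.

Definition entropy (R : realType) (alpha x : R) : R :=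
  if alpha == 0 then - ln x else x `^ alpha / (alpha * (alpha - 1)).

(* Grid functions on the discrete torus with N points are functions on 'I_N;
   the neighbours i + 1 and i - 1 modulo N are [ordS i] and [ord_pred i]. *)
Section Scheme.
Variables (R : realType) (a b alpha beta : R) (N : nat).

Definition mesh : R := N%:R^-1.
Local Notation h := mesh.

Section Spatial.
Variables u ubar : 'I_N -> R.

(* The entropy variable, i.e. the derivative of [entropy alpha] at [u i]. *)
Definition v (i : 'I_N) : R := u i `^ (alpha - 1) / (alpha - 1).

Definition xi2 (i : 'I_N) : R :=
  1 / (v i * h ^+ 2) * (v (ordS i) - 2 * v i + v (ord_pred i)).

(* The nonnegative quantity written xi_{1,i}^2; xi_{1,i} itself never occurs. *)
Definition xi1sq (i : 'I_N) : R :=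
  1 / (2 * v i ^+ 2 * h ^+ 2)
  * ((v (ordS i) - v i) ^+ 2 + (v i - v (ord_pred i)) ^+ 2).

Definition A (i : 'I_N) : R :=
  ubar i `^ (alpha + beta) / ((alpha - 1) ^+ 2 * v i)
  * (lambda1 a b alpha beta * xi2 i + lambda2 a b alpha beta * xi1sq i).

Definition B (i : 'I_N) : R :=
  ubar i `^ (alpha + beta) / ((alpha - 1) ^+ 2 * v i ^+ 2)
  * (lambda3 a b alpha beta * xi2 i + lambda4 a b alpha beta * xi1sq i).

(* [J i] is the flux J_{i+1/2}, so that J_{i-1/2} is [J (ord_pred i)]. *)
Definition J (i : 'I_N) : R :=
  1 / h * (A (ordS i) - A i)
  - 1 / (2 * h) * (v (ordS i) + v i) * (B (ordS i) - B i).

Definition discrete_entropy : R := h * \sum_(i < N) entropy alpha (u i).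

End Spatial.

(* The averages [ubar t i] are arbitrary positive numbers. *)
Definition positive_solution (u ubar : R -> 'I_N -> R) : Prop :=
  forall t : R, 0 < t -> forall i : 'I_N,
    [/\ 0 < u t i,
        0 < ubar t i
      & is_derive t 1 (fun s : R => u s i)
          (- (1 / h) * (J (u t) (ubar t) i - J (u t) (ubar t) (ord_pred i)))].

End Scheme.

(* Main.v *)
(** Summation by parts turns the entropy production into
    [- h / (alpha - 1) ^+ 2] times the sum of
    [ubar i `^ (alpha + beta) * P (xi1, xi2)]: the flux was designed so that the
    discrete chain rule
    [v (i+1) ^+ 2 - 2 v i ^+ 2 + v (i-1) ^+ 2 = 2 h ^+ 2 v i ^+ 2 (xi2 + xi1sq)]
    is exact. The coefficients satisfy [lambda1 - lambda3 = 1], and completing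
    the square in [P] leaves exactly [K / (3 (alpha - 1)) ^+ 2 * xi1 ^+ 4]. *)

Require Import Defs.
From HB Require Import structures.
From mathcomp Require Import all_boot all_order all_algebra.
From mathcomp Require Import all_classical all_reals all_analysis.
From mathcomp Require Import ring lra.
Import Order.TTheory GRing.Theory Num.Theory.
Import numFieldNormedType.Exports.
Local Open Scope ring_scope.

Lemma sum_ordS {V : nmodType} {N : nat} (f : 'I_N -> V) :
  \sum_(i < N) f (ordS i) = \sum_(i < N) f i.
Proof. by rewrite [RHS](reindex (@ordS N)) //; exact/onW_bij/ordS_bij. Qed.

(** Shifting the index by one step in the second half of the split sum matches the terms. The grid
    is periodic, so no boundary terms appear. *)
Lemma sum_by_parts_backward {R : comNzRingType} {N : nat} (w F : 'I_N -> R) :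
  \sum_(i < N) w i * (F i - F (ord_pred i)) =
  - \sum_(i < N) F i * (w (ordS i) - w i).
Proof.
under eq_bigr do rewrite mulrBr.
rewrite sumrB -(sum_ordS (fun i => w i * F (ord_pred i))) -sumrB -sumrN.
by apply: eq_bigr => i _; rewrite ordSK; ring.
Qed.

Lemma sum_by_parts_forward {R : comNzRingType} {N : nat} (w F : 'I_N -> R) :
  \sum_(i < N) (F (ordS i) - F i) * (w (ordS i) - w i) =
  - \sum_(i < N) F i * (w (ordS i) - 2 * w i + w (ord_pred i)).
Proof.
rewrite [in RHS](eq_bigr (fun i =>
  F i * (w (ordS i) - w i) - F i * (w i - w (ord_pred i)))); last first.
  by move=> i _; ring.
rewrite sumrB -(sum_ordS (fun i => F i * (w i - w (ord_pred i)))) -sumrB -sumrN.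
by apply: eq_bigr => i _; rewrite ordSK; ring.
Qed.

(* [P] with [x] for [xi2] and [y] for [xi1 ^+ 2], since the scheme only provides
   [xi1sq]. *)
Definition Pquad {R : realType} (a b alpha beta x y : R) : R :=
  (lambda1 a b alpha beta - lambda3 a b alpha beta) * x ^+ 2
  + (lambda2 a b alpha beta - lambda3 a b alpha beta - lambda4 a b alpha beta)
    * x * y
  - lambda4 a b alpha beta * y ^+ 2.

(** With [r] the coefficient of [y] inside the square, the cross coefficient of [Pquad] is [2 * r],
    and [- lambda4 - r ^+ 2] is the coefficient of the remaining [y ^+ 2]. *)
Lemma Pquad_square {R : realType} (a b alpha beta x y : R) :
  alpha != 1 -> beta - 2 * alpha + 3 != 0 ->
  Pquad a b alpha beta x y =
  (x + (beta - 2 * alpha + 3) / (3 * (alpha - 1)) * y) ^+ 2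
  + K a b alpha beta / (3 * (alpha - 1)) ^+ 2 * y ^+ 2.
Proof.
rewrite -subr_eq0 => ha hD.
rewrite /Pquad /lambda1 /lambda2 /lambda3 /lambda4 /K.
by field; rewrite ha hD.
Qed.

(* With [c] the constant below, [1 - c] times the difference of the two sides is
   [((1 - c) x + r y) ^+ 2 + (c y) ^+ 2 + (k - c (1 + r ^+ 2 + k)) y ^+ 2]; this
   [c] is chosen to kill the last term. *)
Lemma square_form_coercive {R : realFieldType} (r k x y : R) : 0 < k ->
  k / (1 + r ^+ 2 + k) * (x ^+ 2 + y ^+ 2) <= (x + r * y) ^+ 2 + k * y ^+ 2.
Proof.
move=> k0; have r0 := sqr_ge0 r; set c := k / _.
have d0 : 0 < 1 + r ^+ 2 + k by lra.
have kc : k = c * (1 + r ^+ 2 + k) by rewrite /c divfK // gt_eqF.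
have c1 : 0 < 1 - c by rewrite subr_gt0 /c ltr_pdivrMr // mul1r; lra.
rewrite -subr_ge0 -(pmulr_rge0 _ c1).
rewrite (_ : _ * _ = ((1 - c) * x + r * y) ^+ 2 + (c * y) ^+ 2).
  by rewrite addr_ge0 ?sqr_ge0.
suff : (k - c * (1 + r ^+ 2 + k)) * y ^+ 2 = 0 by move: c kc c1 => c _ _ E; lra.
by rewrite -kc subrr mul0r.
Qed.

Lemma is_derive_entropy {R : realType} (alpha x : R) : alpha != 1 -> 0 < x ->
  is_derive x 1 (entropy alpha) (x `^ (alpha - 1) / (alpha - 1)).
Proof.
(* The logarithmic case fits the same formula: at [alpha = 0] the claimed derivative is
   [x^-1 / (-1)]. *)
move=> ha x0; have [->|a0] := eqVneq alpha 0.
  rewrite (_ : entropy 0 = - @ln R); last first.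
    by apply/funext => y; rewrite /entropy eqxx.
  rewrite sub0r powR_inv1 ?ltW // invrN1 mulrN1.
  exact/is_deriveN/is_derive1_ln.
rewrite (_ : entropy alpha =
    (alpha * (alpha - 1))^-1 \*: (fun y : R => y `^ alpha)); last first.
  by apply/funext => y; rewrite /entropy (negbTE a0) /= [RHS]mulrC.
apply: is_derive_eq; first exact/is_deriveZ/is_derive1_powR.
by rewrite /GRing.scale /=; field; rewrite a0 subr_eq0 ha.
Qed.

Section EntropyProduction.
Context {R : realType} (a b alpha beta : R) {N : nat}.
Hypotheses (halpha1 : alpha != 1) (N0 : (0 < N)%N).
Local Notation h := (mesh R N).

Lemma is_derive_discrete_entropy (u : R -> 'I_N -> R) (du : 'I_N -> R) (t : R) :
  (forall i, 0 < u t i) ->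
  (forall i, is_derive t 1 (fun s => u s i) (du i)) ->
  is_derive t 1 (fun s => discrete_entropy alpha (u s))
    (h * \sum_(i < N) v alpha (u t) i * du i).
Proof.
move=> u0 hu.
rewrite (_ : (fun s => _) =
    h \*: (\sum_(i < N) (entropy alpha \o (fun s => u s i)))); last first.
  by apply/funext => s; rewrite /discrete_entropy /= fct_sumE.
apply/is_deriveZ/is_derive_sum => i.
by apply: (is_derive1_comp _ (hu i)); exact: is_derive_entropy.
Qed.

Lemma entropy_production (u ubar : 'I_N -> R) : (forall i, 0 < u i) ->
  h * \sum_(i < N) v alpha u i *
    - (1 / h * (J a b alpha beta u ubar i
                - J a b alpha beta u ubar (ord_pred i))) =
  - (h / (alpha - 1) ^+ 2 * \sum_(i < N) ubar i `^ (alpha + beta) *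
      Pquad a b alpha beta (xi2 alpha u i) (xi1sq alpha u i)).
Proof.
move=> u0; set w := v alpha u; set Ai := A a b alpha beta u ubar.
set Bi := B a b alpha beta u ubar; set Ji := J a b alpha beta u ubar.
have h0 : h != 0 by rewrite invr_eq0 pnatr_eq0 -lt0n.
have a0 : alpha - 1 != 0 by rewrite subr_eq0.
have w0 i : w i != 0 by rewrite mulf_neq0 ?invr_eq0 // gt_eqF ?powR_gt0.
have -> : h * \sum_(i < N) w i * - (1 / h * (Ji i - Ji (ord_pred i))) =
    \sum_(i < N) Ji i * (w (ordS i) - w i).
  rewrite -[RHS]opprK -sum_by_parts_backward mulr_sumr -sumrN.
  by apply: eq_bigr => i _; field.
(* The mean of [w] in the flux times the difference of [w] is half a difference of [w ^+ 2], so the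
   [B] part can also be summed by parts, against [w ^+ 2]. *)
have -> : \sum_(i < N) Ji i * (w (ordS i) - w i) =
    1 / h * \sum_(i < N) (Ai (ordS i) - Ai i) * (w (ordS i) - w i)
    - 1 / (2 * h) *
      \sum_(i < N) (Bi (ordS i) - Bi i) * (w (ordS i) ^+ 2 - w i ^+ 2).
  rewrite !mulr_sumr -sumrB; apply: eq_bigr => i _.
  by rewrite /Ji /J -/w -/Ai -/Bi; field.
rewrite sum_by_parts_forward (sum_by_parts_forward (fun i => w i ^+ 2)).
rewrite !mulrN -opprD; congr (- _).
rewrite !mulr_sumr -sumrB; apply: eq_bigr => i _.
(* The second differences of [w] and [w ^+ 2] supply factors [w i] and [w i ^+ 2], which cancel the
   denominators of [A] and [B]. Only the weight in [ubar] remains, so the choice of average is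
   immaterial. *)
rewrite /Ai /Bi /A /B /Pquad /xi2 /xi1sq -/w.
by field; rewrite h0 a0 w0.
Qed.

End EntropyProduction.

Theorem theorem5 (R : realType) (a b alpha beta : R)
    (hbeta : 0 <= beta) (halpha : 0 <= alpha) (halpha1 : alpha != 1)
    (hden : beta - 2 * alpha + 3 != 0) :
  (0 <= K a b alpha beta ->
     forall (N : nat) (u ubar : R -> 'I_N -> R), (0 < N)%N ->
     positive_solution a b alpha beta u ubar ->
     forall t : R, 0 < t ->
       derivable (fun s : R => discrete_entropy alpha (u s)) t 1 /\
       derive1 (fun s : R => discrete_entropy alpha (u s)) t <= 0)
  /\
  (0 < K a b alpha beta ->
     exists c0 : R,
       [/\ 0 < c0,
           forall xi1 xi2 : R,
             c0 * (xi2 ^+ 2 + xi1 ^+ 4) <= P a b alpha beta xi1 xi2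
         & forall (N : nat) (u ubar : R -> 'I_N -> R), (0 < N)%N ->
           positive_solution a b alpha beta u ubar ->
           forall t : R, 0 < t ->
             derivable (fun s : R => discrete_entropy alpha (u s)) t 1 /\
             derive1 (fun s : R => discrete_entropy alpha (u s)) t
             + c0 / (alpha - 1) ^+ 2
               * (mesh R N * \sum_(i < N) ubar t i `^ (alpha + beta)
                  * (xi2 alpha (u t) i ^+ 2 + xi1sq alpha (u t) i ^+ 2))
             <= 0]).
Proof.
(* The arguments swap: [P] takes [xi1] first, [Pquad] takes [xi2] first. *)
have PE x y : P a b alpha beta x y = Pquad a b alpha beta y (x ^+ 2).
  by rewrite /P /Pquad; ring.
set r := (beta - 2 * alpha + 3) / (3 * (alpha - 1)).
set k := K a b alpha beta / (3 * (alpha - 1)) ^+ 2.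
have a2 : 0 < (3 * (alpha - 1)) ^+ 2.
  by rewrite exprn_even_gt0 //= mulf_neq0 ?pnatr_eq0 // subr_eq0.
have QE x y : Pquad a b alpha beta x y = (x + r * y) ^+ 2 + k * y ^+ 2.
  exact: Pquad_square.
have production N (u ubar : R -> 'I_N -> R) (t : R) : (0 < N)%N ->
    positive_solution a b alpha beta u ubar -> 0 < t ->
    is_derive t 1 (fun s => discrete_entropy alpha (u s))
      (- (mesh R N / (alpha - 1) ^+ 2 * \sum_(i < N) ubar t i `^ (alpha + beta) *
        Pquad a b alpha beta (xi2 alpha (u t) i) (xi1sq alpha (u t) i))).
  move=> N0 sol t0; have u0 i : 0 < u t i by have [] := sol t t0 i.
  rewrite -entropy_production //; apply: is_derive_discrete_entropy => // i.
  by have [_ _] := sol t t0 i; rewrite mulNr.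
split=> [K0 N u ubar N0 sol t t0|K0].
  have [dS ES] := production N u ubar t N0 sol t0.
  split=> //; rewrite derive1E ES oppr_le0 mulr_ge0 //.
    by rewrite divr_ge0 ?sqr_ge0 // invr_ge0.
  apply: sumr_ge0 => i _; rewrite mulr_ge0 ?powR_ge0 // QE.
  by rewrite addr_ge0 ?sqr_ge0 // mulr_ge0 ?sqr_ge0 // divr_ge0 // ltW.
have k0 : 0 < k by rewrite divr_gt0.
(* The constant of [square_form_coercive] depends on [a], [b], [alpha], [beta] alone, so it serves
   every grid and every solution. *)
exists (k / (1 + r ^+ 2 + k)).
split=> [|x y|N u ubar N0 sol t t0].
- by rewrite divr_gt0 //; have := sqr_ge0 r; lra.
- by rewrite PE QE (exprM x 2 2); exact: square_form_coercive.
have [dS ES] := production N u ubar t N0 sol t0.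
(* The claim is now that the added dissipation is at most the entropy production. Since the weights
   are nonnegative, coercivity at each grid point suffices. *)
split=> //; rewrite derive1E ES addrC subr_le0.
rewrite [leLHS](_ : _ = mesh R N / (alpha - 1) ^+ 2 *
  \sum_(i < N) ubar t i `^ (alpha + beta) * (k / (1 + r ^+ 2 + k) *
    (xi2 alpha (u t) i ^+ 2 + xi1sq alpha (u t) i ^+ 2))); last first.
  by rewrite !mulr_sumr; apply: eq_bigr => i _; ring.
apply: ler_wpM2l; first by rewrite divr_ge0 ?sqr_ge0 // invr_ge0.
apply: ler_sum => i _; rewrite ler_wpM2l ?powR_ge0 // QE.
exact: square_form_coercive.
Qed.
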